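(* In the binary random graph affiliation mixture model with uniform group priors $\pi_q=1/Q$ and $\alpha\ne\beta$, the parameters $\alpha$, $\beta$ and the number of groups $Q\ge2$ are identifiable from the joint distribution of $K_4$: any two parameter triples $(Q,\alpha,\beta)$, $(Q',\alpha',\beta')$ (with $\alpha\ne\beta$, $\alpha'\ne\beta'$) inducing the same law of $K_4$ are equal.
   Context: Random graph mixture model: nodes have i.i.d. latent groups $Z_i\in\{1,\dots,Q\}$ with $\pi_q=\mathbb P(Z_i=q)$; edge variables $X_{ij}$ ($i<j$) are conditionally independent given all $Z$'s, with law of $X_{ij}$ depending only on $(Z_i,Z_j)$. Binary affiliation model: $X_{ij}\in\{0,1\}$ with $\mathbb P(X_{ij}=1\mid Z_i=q,Z_j=l)=\alpha$ if $q=l$ and $=\beta$ if $q\ne l$. $K_n$ denotes the collection of the $\binom n2$ edge variables among a set of $n$ nodes. *)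

(* Defs.v *)
From HB Require Import structures.
From mathcomp Require Import all_boot all_order all_algebra.
Set Implicit Arguments. Unset Strict Implicit. Unset Printing Implicit Defensive.
Import Order.TTheory GRing.Theory Num.Theory.
Local Open Scope ring_scope.

Definition affil_p (R : rcfType) (Q : nat) (alpha beta : R) (q l : 'I_Q) : R :=
  if q == l then alpha else beta.

Definition bern (R : rcfType) (p : R) (b : bool) : R := if b then p else 1 - p.

(* Probability that the collection K_n of the edge variables X_ij (i < j)
   among n nodes takes the values x i j (only entries with i < j matter),
   under the binary affiliation mixture model with Q groups, uniform prior
   pi_q = 1/Q, and parameters alpha, beta:
     sum over latent assignments z of prod_i pi_{z i} * prod_{i<j} Bern. *)
Definition affil_law (R : rcfType) (n Q : nat) (alpha beta : R)
    (x : 'I_n -> 'I_n -> bool) : R :=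
  \sum_(z : {ffun 'I_n -> 'I_Q})
     (\prod_(i : 'I_n) (Q%:R)^-1) *
     \prod_(i : 'I_n) \prod_(j : 'I_n | (i < j)%N)
        bern (affil_p alpha beta (z i) (z j)) (x i j).

Arguments affil_law {R} n Q alpha beta x.

(* Main.v *)
Require Import Defs.
From HB Require Import structures.
From mathcomp Require Import all_boot all_order all_algebra ring.
Set Implicit Arguments. Unset Strict Implicit. Unset Printing Implicit Defensive.
Import Order.TTheory GRing.Theory Num.Theory.
Local Open Scope ring_scope.

(* Write d := alpha - beta.  The connectivity matrix beta J + d I has eigenvalue
   Q beta + d once and d with multiplicity Q - 1, and the probability that a
   cycle of length k is present in K_4 is Q^-k times the trace of its k-th
   power.  Hence E[X_01] = m := beta + d/Q, and the triangle and 4-cycle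
   probabilities are m^3 + (Q-1) t^3 and m^4 + (Q-1) t^4 with t := d/Q.  The
   two excesses determine t (their quotient) and then Q - 1, hence Q, alpha,
   beta. *)

Section AffiliationKernel.
Variables (R : comPzRingType) (Q : nat).

Definition affil_kernel (b d : R) (q l : 'I_Q) : R := b + d * (q == l)%:R.

Lemma sum_const_ord (x : R) : \sum_(v : 'I_Q) x = Q%:R * x.
Proof. by rewrite sumr_const card_ord mulr_natl. Qed.

Lemma affil_kernelC b d q l : affil_kernel b d q l = affil_kernel b d l q.
Proof. by rewrite /affil_kernel eq_sym. Qed.

Lemma sum_delta_mul (F : 'I_Q -> R) q : \sum_m (m == q)%:R * F m = F q.
Proof.
by rewrite (bigD1 q) //= eqxx mul1r big1 ?addr0 // => m /negbTE ->; rewrite mul0r.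
Qed.

Lemma sum_affil_kernel_row b d q : \sum_l affil_kernel b d q l = Q%:R * b + d.
Proof.
rewrite big_split /= sum_const_ord.
by under eq_bigr => l _ do rewrite eq_sym mulrC; rewrite sum_delta_mul.
Qed.

Lemma sum_affil_kernel_diag b d : \sum_q affil_kernel b d q q = Q%:R * (b + d).
Proof.
by under eq_bigr => q _ do rewrite /affil_kernel eqxx mulr1; rewrite sum_const_ord.
Qed.

Lemma sum_affil_kernel_mul b1 d1 b2 d2 l q :
  \sum_m affil_kernel b1 d1 l m * affil_kernel b2 d2 m q =
  affil_kernel (Q%:R * b1 * b2 + b1 * d2 + d1 * b2) (d1 * d2) l q.
Proof.
transitivity (\sum_m (b1 * b2 + (m == q)%:R * (b1 * d2) + (m == l)%:R * (d1 * b2)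
                      + (m == q)%:R * ((l == q)%:R * d1 * d2))).
  apply: eq_bigr => m _; rewrite /affil_kernel (eq_sym l m).
  case: (eqVneq m q) => [->|_]; rewrite /= ?(eq_sym q l); ring.
by rewrite !big_split /= !sum_delta_mul sum_const_ord /affil_kernel; ring.
Qed.

End AffiliationKernel.

Section FourVertexSums.
Variables (R : comPzRingType) (Q : nat) (b d : R).
Local Notation K := (@affil_kernel R Q b d).
Local Notation s := (Q%:R * b + d).

Lemma sum4_affil_edge :
  \sum_x \sum_y \sum_(w : 'I_Q) \sum_(v : 'I_Q) K x y = Q%:R ^+ 3 * s.
Proof.
under eq_bigr => x _ do under eq_bigr => y _ do
  rewrite (eq_bigr _ (fun w _ => sum_const_ord Q (K x y))) sum_const_ord.
under eq_bigr => x _ do rewrite -mulr_sumr -mulr_sumr sum_affil_kernel_row.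
by rewrite sum_const_ord; ring.
Qed.

Lemma sum4_affil_triangle :
  \sum_x \sum_y \sum_w \sum_(v : 'I_Q) K x y * K x w * K y w =
  Q%:R * (s ^+ 3 + (Q%:R - 1) * d ^+ 3).
Proof.
under eq_bigr => x _ do under eq_bigr => y _ do under eq_bigr => w _ do
  rewrite sum_const_ord -mulrA [K y w]affil_kernelC.
under eq_bigr => x _ do under eq_bigr => y _ do
  rewrite -mulr_sumr -mulr_sumr sum_affil_kernel_mul
          [affil_kernel (_ + _) _ _ _]affil_kernelC.
under eq_bigr => x _ do rewrite -mulr_sumr sum_affil_kernel_mul.
by rewrite -mulr_sumr sum_affil_kernel_diag; ring.
Qed.

Lemma sum4_affil_square :
  \sum_x \sum_y \sum_w \sum_v K x y * K x v * K y w * K w v =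
  s ^+ 4 + (Q%:R - 1) * d ^+ 4.
Proof.
transitivity (\sum_x \sum_y \sum_w \sum_v K x y * (K y w * (K w v * K v x))).
  apply: eq_bigr => x _; apply: eq_bigr => y _; apply: eq_bigr => w _.
  by apply: eq_bigr => v _; rewrite [K v x]affil_kernelC; ring.
under eq_bigr => x _ do under eq_bigr => y _ do under eq_bigr => w _ do
  rewrite -!mulr_sumr sum_affil_kernel_mul.
under eq_bigr => x _ do under eq_bigr => y _ do
  rewrite -mulr_sumr sum_affil_kernel_mul.
under eq_bigr => x _ do rewrite sum_affil_kernel_mul.
by rewrite sum_affil_kernel_diag; ring.
Qed.

End FourVertexSums.

Section EdgeMoments.
Variables (R : rcfType) (n Q : nat) (alpha beta : R).

(* The X_ij with i >= j are not edge variables of K_n: the weight forces them to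
   false, so that each configuration of K_n is counted once and edge_moment E is
   the probability that all edges ij of E with i < j are present. *)
Definition edge_weight (E : rel 'I_n) (p : 'I_n * 'I_n) (x : bool) : R :=
  if (p.1 < p.2)%N then (if E p.1 p.2 then x%:R else 1) else (~~ x)%:R.

Definition edge_moment (E : rel 'I_n) : R :=
  \sum_(X : {ffun 'I_n * 'I_n -> bool})
    affil_law n Q alpha beta (fun i j => X (i, j)) * \prod_p edge_weight E p (X p).

Lemma prod_upper_pairs (F : 'I_n -> 'I_n -> R) :
  \prod_(i : 'I_n) \prod_(j : 'I_n | (i < j)%N) F i j =
  \prod_(p : 'I_n * 'I_n) (if (p.1 < p.2)%N then F p.1 p.2 else 1).
Proof. by under eq_bigr => i _ do rewrite big_mkcond; rewrite pair_big. Qed.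

Lemma edge_momentE E : edge_moment E = Q%:R^-1 ^+ n *
  \sum_(z : {ffun 'I_n -> 'I_Q}) \prod_(p : 'I_n * 'I_n)
     (if (p.1 < p.2)%N && E p.1 p.2 then affil_p alpha beta (z p.1) (z p.2) else 1).
Proof.
rewrite /edge_moment /affil_law.
under eq_bigr => X _ do rewrite mulr_suml.
rewrite exchange_big mulr_sumr; apply: eq_bigr => z _ /=.
rewrite prodr_const card_ord.
under eq_bigr => X _ do rewrite -mulrA.
rewrite -mulr_sumr; congr (_ * _).
under [\sum_x _]eq_bigr => x _ do rewrite (prod_upper_pairs
  (fun i j => bern (affil_p alpha beta (z i) (z j)) (x (i, j)))) -big_split /=.
under eq_bigr => x _ do under eq_bigr => p _ do rewrite -surjective_pairing.
rewrite -(bigA_distr_bigA (fun (p : 'I_n * 'I_n) (x : bool) => (if (p.1 < p.2)%N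
  then bern (affil_p alpha beta (z p.1) (z p.2)) x else 1) * edge_weight E p x)).
apply: eq_bigr => -[i j] _; rewrite big_bool /edge_weight /bern /=.
case: ltnP => _ /=; last by rewrite mulr0 mul1r add0r.
by case: (E i j) => /=; ring.
Qed.

End EdgeMoments.

Arguments edge_moment {R} n Q alpha beta E.

Local Notation "''v_' k" := (@Ordinal 4 k isT) (at level 0, k at level 0).

Lemma sum_ffun_ord4 (V : nmodType) (Q : nat) (F : 'I_Q -> 'I_Q -> 'I_Q -> 'I_Q -> V) :
  \sum_(z : {ffun 'I_4 -> 'I_Q}) F (z 'v_0) (z 'v_1) (z 'v_2) (z 'v_3) =
  \sum_x \sum_y \sum_w \sum_v F x y w v.
Proof.
rewrite !pair_big /=.
pose f (t : 'I_Q * 'I_Q * 'I_Q * 'I_Q) : {ffun 'I_4 -> 'I_Q} :=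
  [ffun i : 'I_4 => match val i with
                    | 0 => t.1.1.1 | 1 => t.1.1.2 | 2 => t.1.2 | _ => t.2 end].
have f_bij : bijective f.
  exists (fun z : {ffun 'I_4 -> 'I_Q} => (z 'v_0, z 'v_1, z 'v_2, z 'v_3))
    => [[[[x y] w] v]|z].
    by rewrite /f !ffunE.
  apply/ffunP => -[[|[|[|[|k]]]] lt_k4]; rewrite ffunE //=; congr (z _); exact: val_inj.
by rewrite (reindex f) //=; [apply: eq_bigr => t _; rewrite !ffunE | exact: onW_bij].
Qed.

Definition edges_of (n : nat) (s : seq (nat * nat)) : rel 'I_n :=
  fun i j => (val i, val j) \in s.
Arguments edges_of {n} s.

Lemma prod_pair (V : comPzSemiRingType) (T : finType) (G : T * T -> V) :
  \prod_p G p = \prod_i \prod_j G (i, j).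
Proof. by rewrite pair_bigA; apply: eq_bigr => -[]. Qed.

Lemma prod_ord4 (V : comPzSemiRingType) (H : 'I_4 -> V) :
  \prod_i H i = H 'v_0 * H 'v_1 * H 'v_2 * H 'v_3.
Proof.
rewrite !big_ord_recr big_ord0 /= mul1r.
by congr (_ * _ * _ * _); congr H; apply: val_inj.
Qed.

Section FourVertexMoments.
Variables (R : rcfType) (Q : nat) (alpha beta : R).
Hypothesis Q_gt0 : (0 < Q)%N.
Local Notation K := (@affil_kernel R Q beta (alpha - beta)).
Local Notation mu := (edge_moment 4 Q alpha beta).

Lemma affil_pE (q l : 'I_Q) : affil_p alpha beta q l = K q l.
Proof. by rewrite /affil_p /affil_kernel; case: eqP => _ /=; ring. Qed.

Let Q_neq0 : Q%:R != 0 :> R. Proof. by rewrite pnatr_eq0 -lt0n. Qed.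

Lemma edge_moment_edge : mu (edges_of [:: (0, 1)]%N) = beta + (alpha - beta) / Q%:R.
Proof.
rewrite edge_momentE (eq_bigr (fun z : {ffun 'I_4 -> 'I_Q} => K (z 'v_0) (z 'v_1)));
  last first.
  by move=> z _; rewrite prod_pair !prod_ord4 /= !mulr1 !mul1r affil_pE.
rewrite (sum_ffun_ord4 (fun x y _ _ => K x y)) sum4_affil_edge.
by field; exact: Q_neq0.
Qed.

Lemma edge_moment_triangle :
  mu (edges_of [:: (0, 1); (0, 2); (1, 2)]%N) =
  (beta + (alpha - beta) / Q%:R) ^+ 3 + (Q%:R - 1) * ((alpha - beta) / Q%:R) ^+ 3.
Proof.
rewrite edge_momentE (eq_bigr (fun z : {ffun 'I_4 -> 'I_Q} =>
  K (z 'v_0) (z 'v_1) * K (z 'v_0) (z 'v_2) * K (z 'v_1) (z 'v_2))); last first.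
  by move=> z _; rewrite prod_pair !prod_ord4 /= !mulr1 !mul1r !affil_pE.
rewrite (sum_ffun_ord4 (fun x y w _ => K x y * K x w * K y w)) sum4_affil_triangle.
by field; exact: Q_neq0.
Qed.

Lemma edge_moment_square :
  mu (edges_of [:: (0, 1); (1, 2); (2, 3); (0, 3)]%N) =
  (beta + (alpha - beta) / Q%:R) ^+ 4 + (Q%:R - 1) * ((alpha - beta) / Q%:R) ^+ 4.
Proof.
rewrite edge_momentE (eq_bigr (fun z : {ffun 'I_4 -> 'I_Q} =>
  K (z 'v_0) (z 'v_1) * K (z 'v_0) (z 'v_3) * K (z 'v_1) (z 'v_2) * K (z 'v_2) (z 'v_3)));
  last first.
  by move=> z _; rewrite prod_pair !prod_ord4 /= !mulr1 !mul1r !affil_pE.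
rewrite (sum_ffun_ord4 (fun x y w v => K x y * K x v * K y w * K w v)) sum4_affil_square.
by field; exact: Q_neq0.
Qed.

End FourVertexMoments.

Lemma cubic_quartic_inj (F : fieldType) (r t r' t' : F) :
  r != 0 -> t != 0 -> r' != 0 -> t' != 0 ->
  r * t ^+ 3 = r' * t' ^+ 3 -> r * t ^+ 4 = r' * t' ^+ 4 -> r = r' /\ t = t'.
Proof.
move=> r0 t0 r'0 t'0 E3 E4.
have t_eq : t = t'.
  transitivity (r * t ^+ 4 / (r * t ^+ 3)); first by field; apply/andP.
  by rewrite E3 E4; field; apply/andP.
by split=> //; apply: (mulIf (expf_neq0 3 t0)); rewrite E3 t_eq.
Qed.

Lemma affil_moments_inj (R : rcfType) (Q Q' : nat) (alpha beta alpha' beta' : R) :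
  (2 <= Q)%N -> (2 <= Q')%N -> alpha != beta -> alpha' != beta' ->
  (forall E, edge_moment 4 Q alpha beta E = edge_moment 4 Q' alpha' beta' E) ->
  [/\ Q = Q', alpha = alpha' & beta = beta'].
Proof.
move=> Q_ge2 Q'_ge2 ab ab' mu_eq.
have nondegenerate (n : nat) (a b : R) : (2 <= n)%N -> a != b ->
    (n%:R - 1 != 0 :> R) /\ (a - b) / n%:R != 0.
  case: n => [|[|n]] // _ ab_neq; split; first by rewrite -natr1 addrK pnatr_eq0.
  by rewrite mulf_neq0 ?invr_eq0 ?pnatr_eq0 ?subr_eq0.
have [r0 t0] := nondegenerate _ _ _ Q_ge2 ab.
have [r'0 t'0] := nondegenerate _ _ _ Q'_ge2 ab'.
have [Q_gt0 Q'_gt0] := (ltnW Q_ge2, ltnW Q'_ge2).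
have := mu_eq (edges_of [:: (0, 1)]%N).
rewrite (edge_moment_edge _ _ Q_gt0) (edge_moment_edge _ _ Q'_gt0) => m1_eq.
have := mu_eq (edges_of [:: (0, 1); (0, 2); (1, 2)]%N).
rewrite (edge_moment_triangle _ _ Q_gt0) (edge_moment_triangle _ _ Q'_gt0) m1_eq.
move=> /addrI m3_eq.
have := mu_eq (edges_of [:: (0, 1); (1, 2); (2, 3); (0, 3)]%N).
rewrite (edge_moment_square _ _ Q_gt0) (edge_moment_square _ _ Q'_gt0) m1_eq.
move=> /addrI m4_eq.
have [/addIr/eqP r_eq t_eq] := cubic_quartic_inj r0 t0 r'0 t'0 m3_eq m4_eq.
have Q_eq : Q = Q' by apply/eqP; rewrite -(eqr_nat R).
subst Q'; have beta_eq : beta = beta' by move: m1_eq; rewrite t_eq => /addIr.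
have Qinv_neq0 : Q%:R^-1 != 0 :> R by rewrite invr_eq0 pnatr_eq0 -lt0n.
by split=> //; move: t_eq; rewrite beta_eq => /(mulIf Qinv_neq0)/addIr.
Qed.

Theorem corollary3 (R : rcfType) (Q Q' : nat) (alpha beta alpha' beta' : R) :
  (2 <= Q)%N -> (2 <= Q')%N ->
  0 <= alpha <= 1 -> 0 <= beta <= 1 ->
  0 <= alpha' <= 1 -> 0 <= beta' <= 1 ->
  alpha != beta -> alpha' != beta' ->
  (forall x : 'I_4 -> 'I_4 -> bool,
      affil_law 4 Q alpha beta x = affil_law 4 Q' alpha' beta' x) ->
  [/\ Q = Q', alpha = alpha' & beta = beta'].
Proof.
move=> Q_ge2 Q'_ge2 _ _ _ _ ab ab' law_eq.
apply: affil_moments_inj => // E.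
by apply: eq_bigr => X _; rewrite law_eq.
Qed.
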